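(* Let $A = \begin{pmatrix} 1 & 1 \\ 1 & -1 \end{pmatrix}$, so that $A^{-1} = \frac12 A$, and let $p \in [1,2]$. Then $$\|A^{-1}\|_{p\to p} = 2^{-1+1/p} = 2^{-\frac{p-1}{p}}.$$ Consequently, for any Boolean function $f:\{-1,+1\}^n \to \{-1,+1\}$ and any coordinate $\ell \in \{1,\dots,n\}$, setting $p_\ell = 1 + \mathrm{Inf}_\ell(f)$ gives $$\|A^{-1}\|_{p_\ell\to p_\ell} = 2^{-\mathrm{Inf}_\ell(f)/(1+\mathrm{Inf}_\ell(f))}.$$
   Context: $\|M\|_{p\to p} = \sup_{v\neq 0}\|Mv\|_p/\|v\|_p$ is the operator norm of a $2\times 2$ matrix $M$ on $\mathbb{R}^2$ with the $\ell_p$ norm. For a Boolean function $f:\{-1,+1\}^n\to\{-1,+1\}$, the influence of coordinate $\ell$ is $\mathrm{Inf}_\ell(f) = \Pr_x[f(x)\ne f(x^{\oplus \ell})] \in [0,1]$, where $x$ is uniform on $\{-1,+1\}^n$ and $x^{\oplus\ell}$ is $x$ with coordinate $\ell$ negated; hence $p_\ell \in [1,2]$. *)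

(* Defs.v *)
From HB Require Import structures.
From mathcomp Require Import all_boot all_order all_algebra.
From mathcomp Require Import all_classical all_reals all_analysis.

Set Implicit Arguments.
Unset Strict Implicit.
Unset Printing Implicit Defensive.

Import Order.TTheory GRing.Theory Num.Theory.

Local Open Scope classical_set_scope.
Local Open Scope ring_scope.

Definition lpnorm (R : realType) (n : nat) (p : R) (v : 'cV[R]_n) : R :=
  (\sum_(i < n) `|v i ord0| `^ p) `^ p^-1.

(* For p > 0 and n > 0 the set of ratios is nonempty and bounded, so the
   real-valued [sup] is a genuine supremum. *)
Definition opnorm (R : realType) (n : nat) (p : R) (M : 'M[R]_n) : R :=
  sup [set lpnorm p (M *m v) / lpnorm p v | v in [set v : 'cV[R]_n | v != 0]].

Definition matA (R : realType) : 'M[R]_2 :=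
  \matrix_(i, j) nth 0 (nth [::] [:: [:: 1; 1]; [:: 1; -1]] i) j.

Notation sign := (seq_sub [:: -1; 1 : int]).

Lemma opp_sign_subproof (s : sign) : - ssval s \in [:: -1; 1 : int].
Proof. by case: s => s /=; rewrite !inE => /orP[] /eqP ->. Qed.

Definition opp_sign (s : sign) : sign := SeqSub (opp_sign_subproof s).

Notation cube n := {ffun 'I_n -> sign}.

Definition flip (n : nat) (l : 'I_n) (x : cube n) : cube n :=
  [ffun i => if i == l then opp_sign (x i) else x i].

(* Probability of the event E for a uniform point of a finite type. *)
Definition Pr_unif (R : realType) (T : finType) (E : pred T) : R :=
  #|E|%:R / #|T|%:R.

Definition Inf (R : realType) (n : nat) (f : cube n -> sign) (l : 'I_n) : R :=
  Pr_unif R [pred x | f x != f (flip l x)].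

(* Main.v *)
(** For [0 < p <= 2], put [q = p / 2]. Concavity of [t `^ q], the parallelogram
    law and subadditivity of [t `^ q] give
    [|x+y|^p + |x-y|^p <= 2 (x^2 + y^2)^q <= 2 (|x|^p + |y|^p)],
    and the first basis vector is an equality case. *)
Require Import Defs.
From HB Require Import structures.
From mathcomp Require Import all_boot all_order all_algebra.
From mathcomp Require Import all_classical all_reals all_analysis.
From mathcomp Require Import ring lra.

Set Implicit Arguments.
Unset Strict Implicit.
Unset Printing Implicit Defensive.

Import Order.TTheory GRing.Theory Num.Theory.
Local Open Scope ring_scope.

(** Derived from convexity: since 1/q >= 1, the map t^(1/q) is convex, and it is applied at the
    midpoint of a^q and b^q. *)
Lemma powR_midpoint_concave (R : realType) (a b q : R) :
  0 <= a -> 0 <= b -> 0 < q <= 1 ->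
  a `^ q + b `^ q <= 2 * ((a + b) / 2) `^ q.
Proof.
move=> a0 b0 /andP[q0 q1].
have r1 : 1 <= q^-1 by rewrite invf_ge1.
have qK (t : R) : 0 <= t -> (t `^ q) `^ q^-1 = t.
  by move=> t0; rewrite -powRrM divff ?gt_eqF// powRr1.
have h0 : (0 : R) <= 2^-1 by rewrite invr_ge0.
have h1 : (2^-1 : R) <= 1 by lra.
have in0y (t : R) : 0 <= t -> t \in (`[0, +oo[%classic : set R).
  by move=> t0; rewrite inE /= in_itv /= t0.
have cvx : ((a `^ q + b `^ q) / 2) `^ q^-1 <= (a + b) / 2.
  have : (2^-1 * a `^ q + (1 - 2^-1) * b `^ q) `^ q^-1 <=
         2^-1 * (a `^ q) `^ q^-1 + (1 - 2^-1) * (b `^ q) `^ q^-1.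
    exact: (convex_powR r1 (Itv01 h0 h1)
      (in0y _ (powR_ge0 a q)) (in0y _ (powR_ge0 b q))).
  have -> : 1 - 2^-1 = 2^-1 :> R by field.
  by rewrite !qK// -!mulrDr ![2^-1 * _]mulrC.
have mid0 : 0 <= (a `^ q + b `^ q) / 2.
  by rewrite divr_ge0// addr_ge0// powR_ge0.
(* The mean of a^q and b^q is written as the q-th power of its own 1/q-th power, so that
   monotonicity of t^q turns [cvx] into the goal. *)
rewrite mulrC -ler_pdivrMr// -[leLHS]qK// powRAC.
by apply: (ge0_ler_powR (ltW q0)) cvx; rewrite nnegrE ?powR_ge0 ?divr_ge0 ?addr_ge0.
Qed.

(** The weights w = s/(s+t) and w = t/(s+t) lie in [0, 1] and add up to 1, and w <= w^q because q <=
    1. Multiplying by (s+t)^q and adding gives the bound. *)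
Lemma powR_subadditive (R : realType) (s t q : R) :
  0 <= s -> 0 <= t -> 0 < q <= 1 -> (s + t) `^ q <= s `^ q + t `^ q.
Proof.
move=> s0 t0 /andP[q0 q1].
have [st0|] := eqVneq (s + t) 0.
  by rewrite st0 powR0 ?gt_eqF// addr_ge0 ?powR_ge0.
move=> stN0.
have st0 : 0 < s + t by rewrite lt_def stN0 addr_ge0.
have part (u : R) : 0 <= u <= s + t -> u / (s + t) * (s + t) `^ q <= u `^ q.
  (* The comparison w <= w^q is invoked for 0 < w <= 1, so u = 0 is treated apart. *)
  move=> /andP[]; rewrite le_eqVlt => /predU1P[<- _|u0 ust].
    by rewrite !mul0r powR_ge0.
  rewrite -[u in leRHS](divfK stN0) powRM ?divr_ge0 ?(ltW u0) ?(ltW st0)//.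
  rewrite ler_wpM2r ?powR_ge0// ger1_powR// divr_gt0//=.
  by rewrite ler_pdivrMr ?mul1r.
apply: le_trans (lerD (part s _) (part t _)); rewrite ?s0 ?t0 ?lerDl ?lerDr//.
by rewrite -mulrDl -mulrDl divff// mul1r.
Qed.

(** Passing to squares makes the parallelogram law applicable to p-th powers of absolute values. *)
Lemma powR_normr_sqr (R : realType) (x p : R) :
  `|x| `^ p = (x ^+ 2) `^ (p / 2).
Proof.
by rewrite -[x ^+ 2]real_normK ?num_real// -powR_mulrn// -powRrM mulrC divfK.
Qed.

Lemma clarkson_le2 (R : realType) (x y p : R) : 0 < p <= 2 ->
  `|x + y| `^ p + `|x - y| `^ p <= 2 * (`|x| `^ p + `|y| `^ p).
Proof.
move=> /andP[p0 p2]; rewrite !powR_normr_sqr.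
have q01 : 0 < p / 2 <= 1 by apply/andP; split; lra.
apply: le_trans (powR_midpoint_concave (sqr_ge0 _) (sqr_ge0 _) q01) _.
have -> : ((x + y) ^+ 2 + (x - y) ^+ 2) / 2 = x ^+ 2 + y ^+ 2 by field.
by rewrite ler_pM2l// powR_subadditive ?sqr_ge0.
Qed.

Lemma sup_attained (R : realType) (E : set R) (m : R) :
  E m -> ubound E m -> sup E = m.
Proof.
move=> Em Em_ub; apply/le_anti/andP; split.
  by apply: ge_sup => //; exists m.
by apply: ub_le_sup => //; exists m.
Qed.

Lemma matA_mul (R : realType) : matA R *m matA R = 2%:M.
Proof.
apply/matrixP=> i j; rewrite !mxE big_ord_recl big_ord1 !mxE.
by case: i j => [[|[|//]] hi] [[|[|//]] hj] /=; ring.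
Qed.

Lemma invmx_matA (R : realType) :
  matA R \in unitmx /\ invmx (matA R) = 2^-1 *: matA R.
Proof.
have H : matA R *m (2^-1 *: matA R) = 1%:M.
  by rewrite -scalemxAr matA_mul scale_scalar_mx mulVf.
have [U _] := mulmx1_unit H; split=> //.
(* With A for [matA R], the inverse times the identity A (A/2) collapses to A/2. *)
by rewrite -[LHS]mulmx1 -H mulKmx.
Qed.

Lemma lpnorm2E (R : realType) (p : R) (v : 'cV[R]_2) :
  lpnorm p v = (`|v ord0 ord0| `^ p + `|v ord_max ord0| `^ p) `^ p^-1.
Proof.
rewrite /lpnorm big_ord_recl big_ord1.
by congr ((_ + `|v _ _| `^ _) `^ _); apply/val_inj.
Qed.

(** A vanishing sum of nonnegative powers forces both coordinates to be 0. Positivity allows the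
    denominator in [opnorm] to be cleared. *)
Lemma lpnorm2_gt0 (R : realType) (p : R) (v : 'cV[R]_2) :
  v != 0 -> 0 < lpnorm p v.
Proof.
move=> v0; rewrite lpnorm2E powR_gt0// lt_def addr_ge0 ?powR_ge0// andbT.
rewrite paddr_eq0 ?powR_ge0// !powR_eq0 !normr_eq0.
apply: contra v0 => /andP[/andP[/eqP x0 _] /andP[/eqP y0 _]].
apply/eqP/colP => -[[|[|//]] hi]; rewrite mxE.
  by rewrite -x0; congr (v _ _); apply/val_inj.
by rewrite -y0; congr (v _ _); apply/val_inj.
Qed.

Lemma lpnorm_half_matA (R : realType) (p : R) (v : 'cV[R]_2) : p != 0 ->
  let x := v ord0 ord0 in let y := v ord_max ord0 in
  lpnorm p ((2^-1 *: matA R) *m v) =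
    2^-1 * (`|x + y| `^ p + `|x - y| `^ p) `^ p^-1.
Proof.
move=> pN0 x y; rewrite lpnorm2E -scalemxAl !mxE !big_ord_recl !big_ord0 !mxE /=.
have -> : lift ord0 ord0 = ord_max :> 'I_2 by apply/val_inj.
rewrite -/x -/y !mul1r mulN1r !addr0 !normrM ger0_norm ?invr_ge0//.
(* Homogeneity: (1/2)^p factors out of the sum, and the outer exponent 1/p turns it back into 1/2 as
   p is nonzero. *)
rewrite !powRM ?invr_ge0// -mulrDr powRM ?powR_ge0 ?addr_ge0 ?powR_ge0//.
by rewrite -powRrM divff// powRr1 ?invr_ge0.
Qed.

Lemma opnorm_invmx_matA (R : realType) (p : R) : 1 <= p <= 2 ->
  opnorm p (invmx (matA R)) = 2 `^ (-1 + 1 / p).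
Proof.
move=> /andP[p1 p2]; have p0 : 0 < p by apply: lt_le_trans p1.
have pN0 : p != 0 by rewrite gt_eqF.
have -> : 2 `^ (-1 + 1 / p) = 2^-1 * 2 `^ p^-1 :> R.
  by rewrite powRD ?pnatr_eq0 ?implybT// powR_inv1// div1r.
rewrite (invmx_matA R).2; apply: sup_attained.
  (* The vector (1, 0) has norm 1 and image (1/2, 1/2), of norm 2^(-1) 2^(1/p). *)
  pose e : 'cV[R]_2 := delta_mx ord0 ord0.
  exists e => /=.
    by apply/eqP => /colP/(_ ord0)/eqP; rewrite !mxE /= oner_eq0.
  rewrite lpnorm_half_matA// lpnorm2E !mxE /= addr0 subr0 normr1 normr0.
  by rewrite powR0// addr0 !powR1 divr1.
move=> _ [v /= v0 <-]; rewrite ler_pdivrMr ?lpnorm2_gt0//.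
rewrite lpnorm_half_matA// lpnorm2E -mulrA ler_pM2l ?invr_gt0//.
(* Once 2^(1/p) is absorbed under the outer power, both sides are 1/p-th powers, and [clarkson_le2]
   compares the bases. *)
rewrite -powRM ?addr_ge0 ?powR_ge0//.
apply: ge0_ler_powR; rewrite ?nnegrE ?invr_ge0 ?(ltW p0)//.
by rewrite clarkson_le2 ?p0.
Qed.

Lemma Pr_unif_ge0_le1 (R : realType) (T : finType) (E : pred T) :
  0 <= Pr_unif R E <= 1.
Proof.
rewrite /Pr_unif divr_ge0//=.
(* On an empty type the quotient is 0, as the inverse of 0 is 0. *)
have [->|T0] := eqVneq #|T| 0%N; first by rewrite invr0 mulr0.
by rewrite ler_pdivrMr ?ltr0n ?lt0n// mul1r ler_nat max_card.
Qed.

Theorem lemma3p3 (R : realType) :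
  [/\ matA R \in unitmx,
      invmx (matA R) = 2^-1 *: matA R,
      forall p : R, 1 <= p <= 2 ->
        opnorm p (invmx (matA R)) = 2 `^ (-1 + 1 / p) /\
        2 `^ (-1 + 1 / p) = 2 `^ (- ((p - 1) / p)) :> R
    & forall (n : nat) (f : cube n -> sign) (l : 'I_n),
        let p_l := 1 + Inf R f l in
        opnorm p_l (invmx (matA R)) =
          2 `^ (- (Inf R f l / (1 + Inf R f l)))].
Proof.
have [U V] := invmx_matA R.
have expE (p : R) : 1 <= p -> -1 + 1 / p = - ((p - 1) / p).
  by move=> p1; field; rewrite gt_eqF// (lt_le_trans _ p1).
split=> // [p p12|n f l p_l].
  by split; [exact: opnorm_invmx_matA | rewrite expE; case/andP: p12].
(* The influence is a probability, which places [p_l] in [1, 2], where the norm formula holds. *)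
have /andP[I0 I1] := Pr_unif_ge0_le1 R [pred x | f x != f (flip l x)].
have p1 : 1 <= p_l by rewrite lerDl.
have p2 : p_l <= 2 by rewrite -[2]/(1 + 1) lerD2l.
by rewrite opnorm_invmx_matA ?p1// expE// [p_l - 1]addrC addKr.
Qed.
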